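(* Let $f$ be a conformal map of $\mathbb{D}$ onto a polygon in $\hat{\mathbb{C}}$, and let $k,m$ be the degrees of the finite Blaschke products $B_k,B_m$ in the representation $$\frac{f''(z)}{f'(z)}=\frac{2B_k(z)/B_m(z)}{1-zB_k(z)/B_m(z)},\qquad z\in\mathbb{D},$$ where $B_k$ and $B_m$ have no common zeros. (i) If $|b|>1$, then $\#\{z\in\mathbb{D}: P_f(z)=b\}=k$. (ii) If $|a|<1$, then $\#\{z\in\mathbb{D}: P_f(z)=a\}=m$. Here solutions are counted with multiplicity.
   Context: $\mathbb{D}=\{z\in\mathbb{C}:|z|<1\}$ and $\hat{\mathbb{C}}=\mathbb{C}\cup\{\infty\}$. A polygon in $\hat{\mathbb{C}}$ is a domain in $\hat{\mathbb{C}}$ whose boundary consists of finitely many line segments, rays or lines. It is known (earlier work) that for a conformal map $f$ of $\mathbb{D}$ onto such a domain, $f''/f'$ has the displayed form for some finite Blaschke products $B_k,B_m$, of degrees $k$ and $m$ respectively, without common zeros, and that $k+1$ is the number of convex vertices and $m$ the number of concave vertices of the polygon. A finite Blaschke product of degree $d$ is $e^{i\theta}\prod_{j=1}^{d}\frac{z-a_j}{1-\overline{a_j}z}$ with $\theta\in\mathbb{R}$, $a_j\in\mathbb{D}$. The pole function is $P_f(z)=z+2\,f'(z)/f''(z)\in\hat{\mathbb{C}}$, with $P_f(z)=\infty$ when $f''(z)=0$; it is a meromorphic function in $\mathbb{D}$. *)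

(* Defs.v *)
From HB Require Import structures.
From mathcomp Require Import all_boot all_order all_algebra.
From mathcomp Require Import all_classical all_reals all_analysis.
From mathcomp Require Import complex.

Set Implicit Arguments.
Unset Strict Implicit.
Unset Printing Implicit Defensive.

Import Order.TTheory GRing.Theory Num.Theory numFieldNormedType.Exports.
Local Open Scope classical_set_scope.
Local Open Scope ring_scope.
Local Open Scope complex_scope.

(* R[i] as a normed space over itself, so that [derivable] and [derive1] are
   complex differentiability and the complex derivative. *)
HB.instance Definition _ (R : realType) := NormedModule.copy R[i] R[i]^o.

(* The Riemann sphere; [Some z] is the finite point z and [None] is infinity. *)
Notation sphere R := (one_point_compactification R[i]).

Section Sphere.
Variable R : realType.
Local Notation C := R[i].

Definition unit_disk : set C := [set z | `|z| < 1].

(* Only meaningful away from infinity, where it takes the junk value 0. *)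
Definition finite_part (w : sphere R) : C := if w is Some z then z else 0.

(* a / b in the sphere, for a and b not both zero. *)
Definition sphere_quot (a b : C) : sphere R :=
  if b == 0 then None else Some (a / b).

Definition sphere_inv (w : sphere R) : sphere R :=
  if w is Some z then sphere_quot 1 z else Some 0.

(* |w| > 1 in the sphere, with |infinity| = infinity. *)
Definition outside_disk (w : sphere R) : Prop :=
  if w is Some z then 1 < `|z| else True.

(* The Moebius map w |-> 2 w / (1 - z w) of the sphere; its value at infinity
   is - 2 / z, which is infinity for z = 0. *)
Definition moebius (z : C) (w : sphere R) : sphere R :=
  if w is Some q then sphere_quot (2 * q) (1 - z * q)
  else sphere_quot 2 (- z).

Inductive edge : Type :=
  | Segment (p q : C)
  | Ray (p v : C)
  | Line (p v : C).

Definition proper_edge (e : edge) : Prop :=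
  match e with
  | Segment p q => p != q
  | Ray _ v | Line _ v => v != 0
  end.

(* As closed subsets of the sphere, rays and lines contain infinity. *)
Definition edge_set (e : edge) : set (sphere R) :=
  match e with
  | Segment p q =>
      [set w | exists2 t : R, 0 <= t <= 1 & w = Some (p + t%:C * (q - p))]
  | Ray p v =>
      [set w | exists2 t : R, 0 <= t & w = Some (p + t%:C * v)] `|` [set None]
  | Line p v =>
      [set w | exists t : R, w = Some (p + t%:C * v)] `|` [set None]
  end.

Definition is_polygon (Omega : set (sphere R)) : Prop :=
  [/\ open Omega, connected Omega, Omega !=set0 &
      exists n (e : 'I_n -> edge), (forall j, proper_edge (e j)) /\
        closure Omega `\` interior Omega = \bigcup_j edge_set (e j)].

Definition conformal_finite_at (F : C -> sphere R) (z : C) : Prop :=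
  [/\ \forall w \near z, F w <> None,
      derivable (finite_part \o F) z 1 &
      derive1 (finite_part \o F) z != 0].

(* At a point where F is infinite, the chart w |-> 1 / w is used. *)
Definition conformal_at (F : C -> sphere R) (z : C) : Prop :=
  if F z is Some _ then conformal_finite_at F z
  else conformal_finite_at (sphere_inv \o F) z.

(* Only the values of f on the unit disk matter. *)
Definition conformal_map_onto (f : C -> sphere R) (Omega : set (sphere R)) :
    Prop :=
  [/\ forall z, unit_disk z -> conformal_at f z,
      set_inj unit_disk f & f @` unit_disk = Omega].

(* f'' / f' as a meromorphic function: infinity at a pole of f, where f'' / f'
   has a simple pole. *)
Definition log_deriv1 (f : C -> sphere R) (z : C) : sphere R :=
  let phi := finite_part \o f in
  if f z is Some _ then Some (derive1 (derive1 phi) z / derive1 phi z)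
  else None.

(* P_f(z) = z + 2 f'(z) / f''(z) as a meromorphic function: at a (simple) pole
   z of f, the function f' / f'' extends by 0, so the value there is z. *)
Definition pole_function (f : C -> sphere R) (z : C) : sphere R :=
  let phi := finite_part \o f in
  let d1 := derive1 phi z in
  let d2 := derive1 (derive1 phi) z in
  if f z is Some _ then (if d2 == 0 then None else Some (z + 2 * d1 / d2))
  else Some z.

Definition finite_blaschke (d : nat) (B : C -> C) : Prop :=
  exists (theta : R) (a : 'I_d -> C),
    (forall j, unit_disk (a j)) /\
    forall z, unit_disk z ->
      B z = (cos theta +i* sin theta) *
            \prod_(j < d) ((z - a j) / (1 - (a j)^* * z)).

(* F - c has a zero of order n at z. *)
Definition zero_order (F : C -> sphere R) (c z : C) (n : nat) : Prop :=
  exists g : C -> C,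
    [/\ \forall w \near z, derivable g w 1, g z != 0 &
        \forall w \near z, F w = Some (c + (w - z) ^+ n * g w)].

Definition multiplicity (F : C -> sphere R) (b : sphere R) (z : C) (n : nat) :
    Prop :=
  if b is Some c then zero_order F c z n
  else zero_order (sphere_inv \o F) 0 z n.

(* The equation F z = b has exactly N solutions z in A, with multiplicity. *)
Definition count_solutions (F : C -> sphere R) (b : sphere R) (A : set C)
    (N : nat) : Prop :=
  exists (s : seq C) (mu : C -> nat),
    [/\ uniq s,
        forall z, z \in s <-> A z /\ F z = b,
        forall z, z \in s -> multiplicity F b z (mu z) &
        (\sum_(z <- s) mu z)%N = N].

End Sphere.

(* Main.v *)
Require Import Defs.
From mathcomp Require Import all_boot all_order all_algebra.
From mathcomp Require Import all_classical all_reals all_analysis.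
From mathcomp Require Import complex ring.

Set Implicit Arguments.
Unset Strict Implicit.
Unset Printing Implicit Defensive.

Import Order.TTheory GRing.Theory Num.Theory numFieldNormedType.Exports.
Local Open Scope classical_set_scope.
Local Open Scope ring_scope.
Local Open Scope complex_scope.

(** Write w = Bk / Bm.  Where f is finite, f'' / f' = 2 w / (1 - z w) turns
    P_f = z + 2 f' / f'' into z + (1 - z w) / w = 1 / w, and the points where
    w, f or P_f is infinite fit the same formula; so P_f = Bm / Bk on the disk
    ([pole_function_quot]).  The two Blaschke products are unimodular on the
    circle, so Bm - c Bk has there the dominant term Bm when |c| < 1 and
    - c Bk when |c| > 1.  By Rouche's theorem it has as many zeros in the disk
    as that term, namely m or k; and P_f = infinity says Bk = 0, which has k
    solutions.  Clearing the nonvanishing denominators turns Bm and Bk into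
    polynomials N and D ([finite_blaschke_pair]), so Rouche's theorem is wanted
    for polynomials only.

    That theorem ([rouche]) is obtained without contour integrals.  The mean of
    z p'(z) / p(z) over the M-th roots of unity equals the sum over the roots
    r of p of 1 / (1 - r ^ M), which tends to the number of roots in the disk
    as M grows, provided that no root lies on the circle
    ([unity_mean_log_deriv]).  A mean over points of the circle is bounded by
    the supremum there, so two polynomials with uniformly close logarithmic
    derivatives on the circle have close root counts ([disk_count_dist]).
    Hence the count along p + t q, 0 <= t <= 1, is Lipschitz in t when
    |p| - |q| is bounded below by a positive constant on the circle; being an
    integer, it is constant. *)

(** * Roots of a polynomial over an algebraically closed field *)

Definition root_seq (F : closedFieldType) (p : {poly F}) : seq F :=
  sval (closed_field_poly_normal p).

Section RootSeq.
Variable F : closedFieldType.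
Implicit Types (p q : {poly F}) (x r : F).

Lemma root_seqE p :
  p = lead_coef p *: \prod_(r <- root_seq p) ('X - r%:P).
Proof. exact: (svalP (closed_field_poly_normal p)). Qed.

Lemma mem_root_seq p x : p != 0 -> (x \in root_seq p) = root p x.
Proof.
move=> p0; rewrite [in RHS](root_seqE p) rootZ ?lead_coef_eq0//.
by rewrite root_prod_XsubC.
Qed.

Lemma root_seqM p q : p != 0 -> q != 0 ->
  perm_eq (root_seq (p * q)) (root_seq p ++ root_seq q).
Proof.
move=> p0 q0; apply: prod_XsubC_eq.
have lc0 : lead_coef (p * q) != 0 by rewrite lead_coef_eq0 mulf_neq0.
apply: (scalerI lc0); rewrite -root_seqE big_cat /=.
by rewrite lead_coefM -scalerA scalerAr scalerAl -!root_seqE.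
Qed.

Lemma root_seq_XsubC r : root_seq ('X - r%:P) = [:: r].
Proof.
apply: perm_small_eq => //; apply: prod_XsubC_eq; rewrite big_seq1.
by rewrite [RHS]root_seqE lead_coefXsubC scale1r.
Qed.

Lemma log_derivE p x : p.[x] != 0 ->
  p^`().[x] / p.[x] = \sum_(r <- root_seq p) (x - r)^-1.
Proof.
set s := root_seq p; rewrite (root_seqE p) -/s derivZ !hornerZ => px0.
move: px0; rewrite mulf_eq0 negb_or => /andP[c0 px0].
rewrite -mulf_div divff// mul1r {c0}; elim: s px0 => [|r s ih].
  by rewrite !big_nil derivC horner0 mul0r.
rewrite !big_cons derivM derivXsubC mul1r hornerD !hornerM hornerXsubC.
rewrite mulf_eq0 negb_or => /andP[xr0 qx0]; rewrite -ih//.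
by field; rewrite qx0.
Qed.

End RootSeq.

(** * Means over roots of unity *)

Section RootsOfUnity.
Variable R : realType.
Local Notation C := R[i].
Implicit Types (p q : {poly C}) (r : C) (M : nat).

Definition unity_roots M : seq C := root_seq ('X^M - 1).

(** A Riemann sum for the mean of [g] over the unit circle. *)
Definition unity_mean M (g : C -> C) : C :=
  (\sum_(z <- unity_roots M) g z) / M%:R.

Lemma unity_rootsE M : (0 < M)%N ->
  'X^M - 1 = \prod_(z <- unity_roots M) ('X - z%:P) :> {poly C}.
Proof.
by move=> M0; rewrite [LHS]root_seqE lead_coefXnsubC// scale1r.
Qed.

Lemma size_unity_roots M : (0 < M)%N -> size (unity_roots M) = M.
Proof.
move=> M0; apply: succn_inj.
by rewrite -(size_prod_XsubC _ id) -unity_rootsE// size_Xn_sub_1.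
Qed.

Lemma norm_unity_root M z : (0 < M)%N -> z \in unity_roots M -> `|z| = 1.
Proof.
move=> M0; rewrite mem_root_seq; last first.
  by rewrite unity_rootsE// monic_neq0// monic_prod_XsubC.
rewrite rootE !hornerE subr_eq0 => /eqP zM1.
by apply/eqP; rewrite -(@pexpr_eq1 _ _ M)// -normrX zM1 normr1.
Qed.

Lemma unity_mean_le M (g : C -> C) (c : C) : (0 < M)%N ->
  (forall z, `|z| = 1 -> `|g z| <= c) -> `|unity_mean M g| <= c.
Proof.
move=> M0 gc; rewrite normrM normfV normr_nat ler_pdivrMr ?ltr0n//.
apply: le_trans (ler_norm_sum _ _ _) _.
rewrite -[in leRHS](size_unity_roots M0) mulr_natr -sum1_size -sumrMnr.
rewrite big_seq [leRHS]big_seq; apply: ler_sum => z /norm_unity_root zu.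
by rewrite gc ?zu.
Qed.

(** Since z / (z - r) = 1 - r / (r - z), summing over the roots z of X^M - 1
    produces the logarithmic derivative of that polynomial at r, which is
    explicit.  This is the discrete form of Cauchy's formula for the winding
    number of the circle around r. *)
Lemma unity_mean_sub_inv M r : (0 < M)%N -> r ^+ M != 1 ->
  unity_mean M (fun z => z / (z - r)) = (1 - r ^+ M)^-1.
Proof.
move=> M0 rM1; have M0' : M%:R != 0 :> C by rewrite pnatr_eq0 -lt0n.
have rM0 : r ^+ M - 1 != 0 by rewrite subr_eq0.
have rM0' : 1 - r ^+ M != 0 by rewrite subr_eq0 eq_sym.
have rz z : z \in unity_roots M -> z - r != 0.
  rewrite mem_root_seq; last first.
    by rewrite unity_rootsE// monic_neq0// monic_prod_XsubC.
  rewrite rootE !hornerE subr_eq0 => /eqP zM1; apply: contra_neq rM1.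
  by move/subr0_eq <-.
have -> : unity_mean M (fun z => z / (z - r)) =
    (\sum_(z <- unity_roots M) (1 - r * (r - z)^-1)) / M%:R.
  congr (_ / _); apply: eq_big_seq => z /rz zr0.
  by field; rewrite zr0 -opprB oppr_eq0 zr0.
rewrite sumrB big_const_seq count_predT size_unity_roots// iter_addr_0 -mulr_sumr.
rewrite -log_derivE ?(hornerE, hornerXn)//.
rewrite derivB derivXn derivC !(hornerE, hornerMn, hornerXn).
case: M M0 M0' rM1 rM0 rM0' {rz} => // M _ M0 _ rM0 rM0' /=.
rewrite exprS in rM0 rM0' *; rewrite -mulr_natr.
by field; rewrite rM0' nat1r M0.
Qed.

Lemma unity_mean_sum M (I : Type) (s : seq I) (g : I -> C -> C) :
  unity_mean M (fun z => \sum_(i <- s) g i z) =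
  \sum_(i <- s) unity_mean M (g i).
Proof. by rewrite /unity_mean exchange_big mulr_suml. Qed.

(** The complex norm is a real number seen as a complex one, so the limit
    reduces to that of a real geometric sequence. *)
Lemma cvg_expr_complex r : `|r| < 1 -> r ^+ M @[M --> \oo] --> (0 : C).
Proof.
move=> r1; apply/cvgr0Pnorm_lt => e e0.
have eE : (complex.Re e)%:C = e by apply: RRe_real; exact: gtr0_real.
set a := complex.Re `|r|; have rE : `|r| = a%:C by [].
have a0 : 0 <= a by rewrite -lecR -rE normr_ge0.
have a1 : `|a| < 1 by rewrite ger0_norm// -ltcR -rE.
have e0' : 0 < complex.Re e by rewrite -ltcR eE.
have /cvgr0Pnorm_lt/(_ _ e0') := @cvg_expr R a a1; apply: filterS => M /=.
rewrite ger0_norm ?exprn_ge0// -ltcR eE => aM.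
by rewrite normrX rE -rmorphXn.
Qed.

Lemma cvg_inv_1subX r : `|r| != 1 ->
  (1 - r ^+ M)^-1 @[M --> \oo] --> ((`|r| < 1)%R%:R : C).
Proof.
have lim0 (q : C) : `|q| < 1 -> 1 - q ^+ M @[M --> \oo] --> (1 - 0 : C).
  by move=> q1; apply: cvgB; [exact: cvg_cst | exact: cvg_expr_complex].
have one0 : 1 - 0 != 0 :> C by rewrite subr0 oner_eq0.
rewrite real_neqr_lt ?normr_real ?real1// => /orP[r1|r1].
  rewrite r1 -[X in _ --> X]invr1 -[X in X^-1](subr0 1).
  by apply: cvgV => //; exact: lim0.
(* Outside the disk, everything is rewritten in powers of 1 / r. *)
have r0 : r != 0 by rewrite -normr_gt0 (lt_trans _ r1).
have q1 : `|r^-1| < 1 by rewrite normfV invf_lt1// normr_gt0.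
rewrite (lt_gtF r1).
have -> : false%:R = - 0 * (1 - 0)^-1 :> C by rewrite oppr0 mul0r.
have -> : (fun M => (1 - r ^+ M)^-1) =
   (fun M => - (r^-1) ^+ M) \* (fun M => (1 - r^-1 ^+ M)^-1).
  apply/funext => M /=; rewrite exprVn.
  have rM : r ^+ M != 0 by rewrite expf_neq0.
  have [->|rM1] := eqVneq (r ^+ M) 1; first by rewrite invr1 subrr invr0 mulr0.
  by field; rewrite !subr_eq0 [1 == _]eq_sym rM1 rM.
apply: cvgM; first by apply: cvgN; exact: cvg_expr_complex.
by apply: cvgV => //; exact: lim0.
Qed.

Definition disk_count p : nat := count (fun r => `|r| < 1) (root_seq p).

(** A discrete argument principle: z p'(z) / p(z) is the sum over the roots r
    of z / (z - r), and each term has mean 1 / (1 - r ^+ M), which tends to 1 or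
    0 according to the side of the circle on which r lies. *)
Lemma unity_mean_log_deriv p : (forall z, `|z| = 1 -> p.[z] != 0) ->
  unity_mean M (fun z => z * (p^`().[z] / p.[z])) @[M --> \oo] -->
  ((disk_count p)%:R : C).
Proof.
move=> pu; have p0 : p != 0.
  by apply/eqP => p0; move: (pu 1 (normr1 _)); rewrite p0 horner0 eqxx.
have ru r : r \in root_seq p -> `|r| != 1.
  by rewrite mem_root_seq//; apply: contraTneq => /pu.
pose s := root_seq p.
suff : \sum_(r <- s) (1 - r ^+ M)^-1 @[M --> \oo] --> ((disk_count p)%:R : C).
  apply: cvg_trans; apply: near_eq_cvg; near=> M.
  have M0 : (0 < M)%N by near: M; exact: nbhs_infty_gt.
  rewrite (_ : unity_mean _ _ =
    unity_mean M (fun z => \sum_(r <- s) (z / (z - r)))).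
    rewrite unity_mean_sum; apply: eq_big_seq => r /ru r1.
    rewrite unity_mean_sub_inv//; apply: contraNneq r1 => rM.
    by rewrite -(@pexpr_eq1 _ _ M)// -normrX rM normr1.
  congr (_ / _); apply: eq_big_seq => z /norm_unity_root zu.
  by rewrite log_derivE ?mulr_sumr ?pu ?zu.
rewrite /disk_count -/s -sum1_count natr_sum big_mkcond /=.
have {}ru : {in s, forall r, `|r| != 1} by [].
elim: s ru => [|r s ih] ru.
  rewrite big_nil; under eq_fun do rewrite big_nil; exact: cvg_cst.
rewrite big_cons; under eq_fun do rewrite big_cons.
apply: cvgD; last by apply: ih => z zs; apply: ru; rewrite inE zs orbT.
have := @cvg_inv_1subX r (ru _ (mem_head _ _)).
by case: ifP.
Unshelve. all: by end_near. Qed.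

End RootsOfUnity.

(** * Rouche's theorem for polynomials *)

Section Rouche.
Variable R : realType.
Local Notation C := R[i].
Implicit Types (p q : {poly C}) (z : C).

(** The means over roots of unity pass this bound to the limit, since each of
    them is dominated by the supremum over the circle. *)
Lemma disk_count_dist p q (e : C) :
  (forall z, `|z| = 1 -> p.[z] != 0) -> (forall z, `|z| = 1 -> q.[z] != 0) ->
  (forall z, `|z| = 1 -> `|p^`().[z] / p.[z] - q^`().[z] / q.[z]| <= e) ->
  `|(disk_count p)%:R - (disk_count q)%:R| <= e.
Proof.
move=> pu qu pqe; have e0 : 0 <= e by rewrite (le_trans _ (pqe 1 (normr1 _))).
have /(_ _)/cvgr_norm_gt lim :=
  cvgB (unity_mean_log_deriv pu) (unity_mean_log_deriv qu).
rewrite real_leNgt ?normr_real ?ger0_real//; apply/negP => /lim [M0 _ gtM].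
have := gtM M0.+1 (leqnSn M0); rewrite /= fctE -mulrBl -sumrB.
apply/negP; rewrite -real_leNgt ?normr_real ?ger0_real//.
rewrite -[X in `|X|]/(unity_mean M0.+1 (fun z =>
  z * (p^`().[z] / p.[z]) - z * (q^`().[z] / q.[z]))).
apply: unity_mean_le => // z z1.
by rewrite -mulrBr normrM z1 mul1r pqe.
Qed.

Lemma horner_circle_bounded p :
  exists2 c : C, 0 <= c & forall z, `|z| = 1 -> `|p.[z]| <= c.
Proof.
exists (\sum_(i < size p) `|p`_i|); first by apply: sumr_ge0.
move=> z z1; rewrite horner_coef (le_trans (ler_norm_sum _ _ _))//.
by apply: ler_sum => i _; rewrite normrM normrX z1 expr1n mulr1.
Qed.

Lemma archi_complex (x : C) : 0 <= x -> exists n : nat, x < n.+1%:R.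
Proof.
move=> x0; have <- : (complex.Re x)%:C = x by apply/RRe_real/ger0_real.
exists (Num.bound (complex.Re x)).
rewrite -(rmorph_nat (real_complex R)) ltcR.
apply: lt_le_trans (archi_boundP _) _; last by rewrite ler_nat.
by rewrite -lecR RRe_real// ger0_real.
Qed.

Lemma eq_nat_of_dist_lt1 (m n : nat) : `|m%:R - n%:R : C| < 1 -> m = n.
Proof.
wlog mn : m n / (m <= n)%N => [hw|].
  by case/orP: (leq_total m n) => [|nm]; [exact: hw | rewrite distrC => /hw ->].
rewrite distrC -natrB// normr_nat ltrn1 ltnS leqn0 subn_eq0 => nm.
by apply/eqP; rewrite eqn_leq mn.
Qed.

(** Rouche's theorem.  The margin [d] replaces the compactness of the circle:
    it bounds p + t q away from 0 for all t in [0, 1] at once.  The difference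
    of the logarithmic derivatives of p + s q and p + t q is
    (s - t) (q' p - p' q) / ((p + s q) (p + t q)), so the root count is
    Lipschitz in t with a constant independent of s and t. *)
Lemma rouche p q (d : C) : 0 < d ->
  (forall z, `|z| = 1 -> `|q.[z]| + d <= `|p.[z]|) ->
  disk_count (p + q) = disk_count p.
Proof.
move=> d0 pqd; pose h (t : C) := p + t *: q.
have hd (t : C) z : 0 <= t <= 1 -> `|z| = 1 -> d <= `|(h t).[z]|.
  move=> /andP[t0 t1] /pqd; rewrite -lerBrDl => /le_trans; apply.
  rewrite hornerD hornerZ (le_trans _ (lerB_normD _ _))// lerB//.
  by rewrite normrM ger0_norm// ler_piMl.
have hu (t : C) : 0 <= t <= 1 -> forall z, `|z| = 1 -> (h t).[z] != 0.
  by move=> t01 z z1; rewrite -normr_gt0 (lt_le_trans d0)// hd.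
have [c c0 Wc] := horner_circle_bounded (q^`() * p - p^`() * q).
have hN (s t : C) : 0 <= s <= 1 -> 0 <= t <= 1 ->
    `|(disk_count (h s))%:R - (disk_count (h t))%:R| <= `|s - t| * (c / d ^+ 2).
  move=> s01 t01; apply: disk_count_dist => [||z z1]; try exact: hu.
  have -> : (h s)^`().[z] / (h s).[z] - (h t)^`().[z] / (h t).[z] =
      (s - t) * (q^`() * p - p^`() * q).[z] / ((h s).[z] * (h t).[z]).
    have hs0 := hu _ s01 _ z1; have ht0 := hu _ t01 _ z1; move: hs0 ht0.
    rewrite /h !derivD !derivZ !(hornerD, hornerZ, hornerM, hornerN).
    by move=> hs0 ht0; field; rewrite ht0.
  rewrite !normrM -mulrA ler_wpM2l// normfV ler_pM ?Wc ?invr_ge0//.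
  have dd : d ^+ 2 <= `|(h s).[z] * (h t).[z]|.
    by rewrite normrM expr2 ler_pM ?hd// ltW.
  by rewrite lef_pV2 ?posrE ?exprn_gt0 ?(lt_le_trans _ dd) ?exprn_gt0.
(* With n.+1 equal steps, each step changes the count by less than 1. *)
have [n Ln] := @archi_complex (c / d ^+ 2) (divr_ge0 c0 (exprn_ge0 _ (ltW d0))).
have n0 : 0 < n.+1%:R :> C by rewrite ltr0n.
have step j : (j <= n.+1)%N -> disk_count (h (j%:R / n.+1%:R)) = disk_count p.
  elim: j => [|j ih] jn; first by rewrite mul0r /h scale0r addr0.
  rewrite -(ih (ltnW jn)); apply: eq_nat_of_dist_lt1.
  have in01 i : (i <= n.+1)%N -> 0 <= (i%:R / n.+1%:R : C) <= 1.
    by move=> iN; rewrite divr_ge0 ?ler0n//= ler_pdivrMr// mul1r ler_nat.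
  apply: le_lt_trans (hN _ _ (in01 _ jn) (in01 _ (ltnW jn))) _.
  rewrite -mulrBl -natrB// subSnn mul1r ger0_norm ?invr_ge0 ?ler0n//.
  by rewrite mulrC ltr_pdivrMr// mul1r.
have := step n.+1 (leqnn _); rewrite divff ?gt_eqF// /h scale1r; exact.
Qed.

Lemma rouche_neq0 p q (d : C) : 0 < d ->
  (forall z, `|z| = 1 -> `|q.[z]| + d <= `|p.[z]|) -> p + q != 0.
Proof.
move=> d0 pqd; apply/eqP => /addr0_eq pq; move: (pqd 1 (normr1 _)).
by rewrite -pq hornerN normrN gerDl lt_geF.
Qed.

End Rouche.

(** * Polynomials as differentiable functions *)

Section HornerCalculus.
Variable K : numFieldType.

Lemma derivable_horner_numField (p : {poly K}) (z : K) : derivable (horner p) z 1.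
Proof.
elim/poly_ind: p => [|p c ih].
  rewrite (_ : horner 0 = cst 0); first exact: derivable_cst.
  by apply/funext => w; rewrite horner0.
rewrite (_ : horner _ = (horner p * id + cst c)); last first.
  by apply/funext => w; rewrite !hornerE.
apply: derivableD; last exact: derivable_cst.
apply: derivableM; first exact: ih.
exact: derivable_id.
Qed.

Lemma derivable_horner_quot (p q : {poly K}) z : q.[z] != 0 ->
  derivable (fun w => p.[w] / q.[w]) z 1.
Proof.
move=> qz; apply: derivableM; first exact: derivable_horner_numField.
by apply: derivableV => //; exact: derivable_horner_numField.
Qed.

Lemma near_horner_neq0 (p : {poly K}) z :
  p.[z] != 0 -> \forall w \near z, p.[w] != 0.
Proof.
have /derivable1_diffP/differentiable_continuous pc :=
  @derivable_horner_numField p z.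
by move=> pz0; apply: cvgr_neq0 pc pz0.
Qed.

End HornerCalculus.


(** * Counting solutions of N / D = b for polynomials N and D *)

Section Counting.
Variable R : realType.
Local Notation C := R[i].
Implicit Types (p q : {poly C}) (z : C).

Lemma disk_countM p q : p != 0 -> q != 0 ->
  disk_count (p * q) = (disk_count p + disk_count q)%N.
Proof.
by move=> p0 q0; rewrite /disk_count (permP (root_seqM p0 q0)) count_cat.
Qed.

Lemma disk_count_eq0 p : p != 0 -> (forall z, `|z| < 1 -> p.[z] != 0) ->
  disk_count p = 0%N.
Proof.
move=> p0 pD; apply/eqP; rewrite -leqn0 leqNgt -has_count.
apply/hasPn => z; rewrite mem_root_seq// rootE.
by apply: contraTN => /pD.
Qed.

Lemma disk_countZ (c : C) p : c != 0 -> p != 0 ->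
  disk_count (c *: p) = disk_count p.
Proof.
move=> c0 p0; rewrite -mul_polyC disk_countM ?polyC_eq0//.
by rewrite disk_count_eq0 ?polyC_eq0// => z _; rewrite hornerC.
Qed.

Lemma disk_count_prod_XsubC d (a : 'I_d -> C) : (forall j, `|a j| < 1) ->
  disk_count (\prod_j ('X - (a j)%:P)) = d.
Proof.
elim: d a => [|d ih] a aD.
  by rewrite big_ord0 disk_count_eq0 ?oner_eq0// => z _; rewrite hornerC oner_eq0.
rewrite big_ord_recl disk_countM ?monic_neq0 ?monicXsubC ?monic_prod_XsubC//.
by rewrite ih// /disk_count root_seq_XsubC /= aD.
Qed.

Lemma sum_count_undup (T : eqType) (s : seq T) :
  (\sum_(x <- undup s) count_mem x s)%N = size s.
Proof.
rewrite -[RHS](perm_size (perm_count_undup s)) size_flatten /shape -map_comp.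
rewrite sumnE big_map; apply: eq_bigr => x _ /=; by rewrite size_nseq.
Qed.

Lemma count_solutions_root_seq (F : C -> sphere R) b p : p != 0 ->
  (forall z, `|z| < 1 -> F z = b <-> root p z) ->
  (forall z, `|z| < 1 -> root p z ->
     multiplicity F b z (count_mem z (root_seq p))) ->
  count_solutions F b (@unit_disk R) (disk_count p).
Proof.
move=> p0 Fb mul; pose s := [seq z <- root_seq p | `|z| < 1].
have sP z : (z \in undup s) = (`|z| < 1) && root p z.
  by rewrite mem_undup mem_filter mem_root_seq.
exists (undup s), (fun z => count_mem z (root_seq p)); split.
- exact: undup_uniq.
- move=> z; rewrite sP; split=> [/andP[zD zp]|[zD /(Fb _ zD) zp]].
    by split=> //; exact/Fb.
  exact/andP.
- by move=> z; rewrite sP => /andP[zD zp]; exact: mul.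
- rewrite /disk_count -size_filter -/s -(sum_count_undup s).
  apply: eq_big_seq => z; rewrite sP => /andP[zD _].
  rewrite count_filter; apply: eq_count => x /=.
  by case: eqVneq => // ->; rewrite zD.
Qed.

(** The cofactor required by [zero_order] collects the other roots. *)
Lemma root_seq_factor p z : p != 0 ->
  exists2 q, q.[z] != 0 & p = ('X - z%:P) ^+ count_mem z (root_seq p) * q.
Proof.
move=> p0; set s := root_seq p.
exists (lead_coef p *: \prod_(r <- s | r != z) ('X - r%:P)).
  rewrite hornerZ mulf_neq0 ?lead_coef_eq0// horner_prod.
  rewrite prodf_seq_neq0; apply/allP => r _; apply/implyP => rz.
  by rewrite hornerXsubC subr_eq0 eq_sym.
rewrite {1}(root_seqE p) -/s -scalerAr; congr (_ *: _).
rewrite (bigID (pred1 z)) /=; congr (_ * _).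
rewrite (eq_bigr (fun=> 'X - z%:P)); last by move=> r /eqP ->.
by rewrite big_const_seq iter_mulr_1.
Qed.

Lemma near_unit_disk z : `|z| < 1 -> \forall w \near z, `|w| < 1.
Proof.
by move=> z1; apply: (@cvgr_norm_lt C C C (nbhs z) _ id z) => //; exact: cvg_id.
Qed.

(** N / D - c = (N - c D) / D, and dividing by D does not change the order of
    a zero at a point where D does not vanish. *)
Lemma zero_order_quot (F : C -> sphere R) (N D : {poly C}) c z :
  (\forall w \near z, F w = sphere_quot N.[w] D.[w]) ->
  N - c *: D != 0 -> D.[z] != 0 ->
  zero_order F c z (count_mem z (root_seq (N - c *: D))).
Proof.
move=> FE p0 Dz; have [q qz pE] := root_seq_factor z p0.
set n := count_mem _ _ in pE *.
exists (fun w => q.[w] / D.[w]); split.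
- apply: filterS (near_horner_neq0 Dz) => w; exact: derivable_horner_quot.
- by rewrite mulf_neq0 ?invr_eq0.
- near=> w; have Dw : D.[w] != 0 by near: w; exact: near_horner_neq0.
  have -> : F w = sphere_quot N.[w] D.[w] by near: w.
  rewrite /sphere_quot (negbTE Dw); congr Some.
  have : (N - c *: D).[w] = (w - z) ^+ n * q.[w].
    by rewrite {1}pE hornerM horner_exp hornerXsubC.
  rewrite !(hornerD, hornerN, hornerZ) mulrA => <-.
  by field.
Unshelve. all: by end_near. Qed.

(** As N and D have no common zero in the disk, no solution of N = c D there is
    a zero of D, and the poles of N / D are exactly the zeros of D. *)
Lemma count_solutions_quot (F : C -> sphere R) (N D : {poly C}) b :
  (forall z, `|z| < 1 -> F z = sphere_quot N.[z] D.[z]) ->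
  (forall z, `|z| < 1 -> ~ (N.[z] = 0 /\ D.[z] = 0)) ->
  let p := if b is Some c then N - c *: D else D in
  p != 0 -> count_solutions F b (@unit_disk R) (disk_count p).
Proof.
move=> FE ND /= p0.
have nearF z : `|z| < 1 -> \forall w \near z, F w = sphere_quot N.[w] D.[w].
  by move=> /near_unit_disk; apply: filterS.
apply: count_solutions_root_seq => // z zD.
  rewrite FE// /sphere_quot rootE; have := ND z zD; case: b p0 => [c|] p0 nd.
    rewrite !(hornerD, hornerN, hornerZ) subr_eq0.
    have [D0|D0] := eqVneq D.[z] 0.
      by split=> // /eqP; rewrite D0 mulr0 => N0; case: nd.
    by split=> [[<-]|/eqP ->]; rewrite ?divfK ?mulfK.
  by case: eqVneq.
have := ND z zD; case: b p0 => [c|] p0 nd; rewrite rootE => /eqP pz.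
  apply: zero_order_quot => //; first exact: nearF.
  apply/eqP => D0; apply: nd; split=> //; move: pz.
  by rewrite !(hornerD, hornerN, hornerZ) D0 mulr0 subr0.
(* At a pole, the chart at infinity turns the quotient into D / N, with a zero
   of the same order as D. *)
have Nz : N.[z] != 0 by apply/eqP => N0; exact: nd.
rewrite -[D in count_mem _ (root_seq D)]subr0 -(scale0r N).
apply: zero_order_quot => //; last by rewrite scale0r subr0.
near=> w; have Nw : N.[w] != 0 by near: w; exact: near_horner_neq0.
rewrite /= (near (nearF z zD) w)// /sphere_quot (negbTE Nw).
have [->|Dw] := eqVneq; first by rewrite mul0r.
by rewrite /= /sphere_quot mulf_eq0 invr_eq0 (negbTE Nw) (negbTE Dw)/=
  mul1r invf_div.
Unshelve. all: by end_near. Qed.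

End Counting.

(** * Blaschke products as quotients of polynomials *)

Section Blaschke.
Variable R : realType.
Local Notation C := R[i].
Implicit Types (p : {poly C}) (z r : C).

Definition blaschke_num d (a : 'I_d -> C) : {poly C} :=
  \prod_j ('X - (a j)%:P).

Definition blaschke_den d (a : 'I_d -> C) : {poly C} :=
  \prod_j (1 - (a j)^* *: 'X).

Lemma horner_blaschke_num d (a : 'I_d -> C) z :
  (blaschke_num a).[z] = \prod_j (z - a j).
Proof. by rewrite horner_prod; apply: eq_bigr => j _; rewrite hornerXsubC. Qed.

Lemma horner_blaschke_den d (a : 'I_d -> C) z :
  (blaschke_den a).[z] = \prod_j (1 - (a j)^* * z).
Proof. by rewrite horner_prod; apply: eq_bigr => j _; rewrite !hornerE. Qed.

(** On the circle 1 = conj z * z, so 1 - conj r * z = conj (z - r) * z. *)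
Lemma norm_blaschke_factor z r : `|z| = 1 -> `|1 - r^* * z| = `|z - r|.
Proof.
move=> z1; have <- : z^* * z = 1 by rewrite mulrC -sqr_normc z1 expr1n.
by rewrite -mulrBl normrM z1 mulr1 -rmorphB normcJ.
Qed.

Section Disk.
Variables (d : nat) (a : 'I_d -> C).
Hypothesis aD : forall j, `|a j| < 1.

Lemma norm_blaschke_num_den z : `|z| = 1 ->
  `|(blaschke_num a).[z]| = `|(blaschke_den a).[z]|.
Proof.
move=> z1; rewrite horner_blaschke_num horner_blaschke_den !normr_prod.
by apply: eq_bigr => j _; rewrite norm_blaschke_factor.
Qed.

Lemma blaschke_den_neq0 z : `|z| <= 1 -> (blaschke_den a).[z] != 0.
Proof.
move=> z1; rewrite horner_blaschke_den prodf_seq_neq0; apply/allP => j _ /=.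
rewrite subr_eq0 eq_sym; apply: contraTneq (aD j) => az.
rewrite -normcJ -real_leNgt ?normr_real ?real1//.
by rewrite -[leLHS](normr1 C) -az normrM ler_piMr.
Qed.

Lemma blaschke_num_ge z : `|z| = 1 ->
  \prod_j (1 - `|a j|) <= `|(blaschke_num a).[z]|.
Proof.
move=> z1; rewrite horner_blaschke_num normr_prod; apply: ler_prod => j _.
by rewrite subr_ge0 ltW//= -z1 lerB_dist.
Qed.

(** This product is a lower bound for the numerator on the circle, by
    [blaschke_num_ge]; it supplies the margin required by [rouche]. *)
Lemma blaschke_margin_gt0 : 0 < \prod_j (1 - `|a j|).
Proof. by apply: prodr_gt0 => j _; rewrite subr_gt0. Qed.

Lemma poly_neq0_horner p z : p.[z] != 0 -> p != 0.
Proof. by apply: contraNneq => ->; rewrite horner0. Qed.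

Lemma disk_count_blaschke_num : disk_count (blaschke_num a) = d.
Proof. exact: disk_count_prod_XsubC. Qed.

Lemma disk_count_blaschke_den : disk_count (blaschke_den a) = 0%N.
Proof.
apply: disk_count_eq0 => [|z /ltW]; last exact: blaschke_den_neq0.
by apply: (@poly_neq0_horner _ 0); rewrite blaschke_den_neq0// normr0.
Qed.

End Disk.

Lemma norm_cos_sin (t : R) : `|cos t +i* sin t| = 1 :> C.
Proof. by rewrite normc_def /= cos2Dsin2 sqrtr1. Qed.

(** Over the common denominator E, the product of both denominators, Bm has the
    numerator N formed of its own zeros and the zeros of the denominator of Bk;
    the latter lie outside the disk and do not count.  Equality of the
    moduli of N and D on the circle is what remains there of |Bm| = |Bk| = 1. *)
Lemma finite_blaschke_pair k m (Bk Bm : C -> C) :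
  finite_blaschke k Bk -> finite_blaschke m Bm ->
  exists (N D E : {poly C}) (g : C),
  [/\ 0 < g /\ (forall z, `|z| = 1 -> g <= `|N.[z]| /\ `|N.[z]| = `|D.[z]|),
      disk_count N = m, disk_count D = k &
      forall z, `|z| < 1 ->
        [/\ E.[z] != 0, Bm z = N.[z] / E.[z] & Bk z = D.[z] / E.[z]]].
Proof.
move=> [s [b [bD BkE]]] [t [a [aD BmE]]].
set u := cos t +i* sin t in BmE; set v := cos s +i* sin s in BkE.
have u1 : `|u| = 1 by exact: norm_cos_sin.
have v1 : `|v| = 1 by exact: norm_cos_sin.
have u0 : u != 0 by rewrite -normr_eq0 u1 oner_eq0.
have v0 : v != 0 by rewrite -normr_eq0 v1 oner_eq0.
have pn (d : nat) (c : 'I_d -> C) : blaschke_num c != 0.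
  by rewrite monic_neq0 ?monic_prod_XsubC.
have pd (d : nat) (c : 'I_d -> C) : (forall j, `|c j| < 1) ->
    blaschke_den c != 0.
  move=> cD; apply: (@poly_neq0_horner _ 0).
  by rewrite blaschke_den_neq0// normr0.
exists (u *: (blaschke_num a * blaschke_den b)),
  (v *: (blaschke_num b * blaschke_den a)), (blaschke_den a * blaschke_den b),
  (\prod_j (1 - `|a j|) * \prod_j (1 - `|b j|)); split.
- split=> [|z z1]; first by rewrite mulr_gt0 ?blaschke_margin_gt0.
  rewrite !hornerZ !hornerM !normrM u1 v1 !mul1r.
  rewrite -!norm_blaschke_num_den// [RHS]mulrC; split=> //.
  by rewrite ler_pM ?blaschke_num_ge// ltW// blaschke_margin_gt0.
- rewrite disk_countZ ?mulf_neq0 ?pn ?pd// disk_countM ?pn ?pd//.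
  by rewrite disk_count_blaschke_num// disk_count_blaschke_den// addn0.
- rewrite disk_countZ ?mulf_neq0 ?pn ?pd// disk_countM ?pn ?pd//.
  by rewrite disk_count_blaschke_num// disk_count_blaschke_den// addn0.
- move=> z zD; rewrite BmE// BkE// !prodf_div !hornerZ !hornerM.
  rewrite -!(horner_blaschke_den _ z) -!(horner_blaschke_num _ z).
  have dz := blaschke_den_neq0 aD (ltW zD).
  have ez := blaschke_den_neq0 bD (ltW zD).
  by split; [rewrite mulf_neq0 | field; rewrite ez dz ..].
Qed.

End Blaschke.

(** * The pole function as a quotient of Blaschke products *)

Section PoleFunction.
Variable R : realType.
Local Notation C := R[i].
Implicit Types (z : C).

(** Solving d2 / d1 = 2 w / (1 - z w) for
    z + 2 d1 / d2 gives 1 / w.  Here w = B / A may be infinite, and then the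
    value 0 comes from d2 / d1 = - 2 / z. *)
Lemma moebius_pole z (A B d1 d2 : C) : d1 != 0 -> ~ (A = 0 /\ B = 0) ->
  Some (d2 / d1) = moebius z (sphere_quot B A) ->
  (if d2 == 0 then None else Some (z + 2 * d1 / d2)) = sphere_quot A B.
Proof.
move=> d10 AB; rewrite /sphere_quot; have [A0|A0] /= := eqVneq A 0.
  have B0 : B != 0 by apply/eqP => B0; apply: AB.
  rewrite /sphere_quot (negbTE B0) A0 mul0r oppr_eq0.
  case: eqVneq => // z0 [dE]; have d2E : d2 = d1 * (2 / - z).
    by rewrite -dE mulrC divfK.
  have d20 : d2 != 0.
    by rewrite d2E !mulf_neq0 ?invr_eq0 ?oppr_eq0 ?pnatr_eq0.
  by rewrite (negbTE d20) d2E; congr Some; field; rewrite z0 d10.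
rewrite /sphere_quot; case: ifPn => // E0 [dE].
have d2E : d2 = d1 * (2 * (B / A) / (1 - z * (B / A))).
  by rewrite -dE mulrC divfK.
have [B0|B0] := eqVneq B 0.
  by rewrite d2E B0 mul0r !mulr0 mul0r mulr0 eqxx.
have d20 : d2 != 0.
  by rewrite d2E !mulf_neq0 ?invr_eq0 ?pnatr_eq0.
have E1 : A - z * B != 0.
  by apply: contra_neq E0 => /subr0_eq AE; rewrite mulrA -AE divff// subrr.
rewrite (negbTE d20) d2E; congr Some; field.
by rewrite B0 A0 d10 E1.
Qed.

(** The case of a pole of f: the right-hand side is infinite only if
    1 = z w, or if w is infinite and z = 0, and in both cases 1 / w = z. *)
Lemma moebius_eq_infinity z (A B : C) : ~ (A = 0 /\ B = 0) ->
  None = moebius z (sphere_quot B A) -> Some z = sphere_quot A B.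
Proof.
move=> AB; rewrite /sphere_quot; have [A0|A0] /= := eqVneq A 0.
  have B0 : B != 0 by apply/eqP => B0; apply: AB.
  by rewrite /sphere_quot (negbTE B0) A0 mul0r oppr_eq0; case: eqVneq => // ->.
rewrite /sphere_quot; case: ifPn => // /eqP/subr0_eq; rewrite mulrA => zBA _.
have {}zBA : z * B = A by rewrite -[RHS]mul1r zBA divfK.
have B0 : B != 0 by apply: contra_neq A0 => B0; rewrite -zBA B0 mulr0.
by rewrite (negbTE B0) -zBA mulfK.
Qed.

Lemma pole_function_quot (f : C -> sphere R) z (A B : C) :
  conformal_at f z -> ~ (A = 0 /\ B = 0) ->
  log_deriv1 f z = moebius z (sphere_quot B A) ->
  pole_function f z = sphere_quot A B.
Proof.
rewrite /conformal_at /log_deriv1 /pole_function.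
case: (f z) => [w|] cf AB; last exact: moebius_eq_infinity.
by have [_ _ d10] := cf; exact: moebius_pole.
Qed.

End PoleFunction.

Theorem theorem4p12 (R : realType) (f : R[i] -> sphere R)
    (Omega : set (sphere R)) (k m : nat) (Bk Bm : R[i] -> R[i])
    (polygon_Omega : is_polygon Omega)
    (conformal_f : conformal_map_onto f Omega)
    (blaschke_Bk : finite_blaschke k Bk)
    (blaschke_Bm : finite_blaschke m Bm)
    (no_common_zero : forall z, unit_disk z -> ~ (Bk z = 0 /\ Bm z = 0))
    (representation : forall z, unit_disk z ->
       log_deriv1 f z = moebius z (sphere_quot (Bk z) (Bm z))) :
  (forall b : sphere R, outside_disk b ->
     count_solutions (pole_function f) b (@unit_disk R) k) /\
  (forall a : R[i], `|a| < 1 ->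
     count_solutions (pole_function f) (Some a) (@unit_disk R) m).
Proof.
have [N [D [E [g [[g0 ND] dN dD BE]]]]] :=
  finite_blaschke_pair blaschke_Bk blaschke_Bm.
have Pf z : `|z| < 1 -> pole_function f z = sphere_quot N.[z] D.[z].
  move=> zD; have [Ez BmE BkE] := BE z zD; case: conformal_f => [cf _ _].
  rewrite (@pole_function_quot _ f z (Bm z) (Bk z)) ?representation//; last 2 first.
  - exact: cf.
  - by move=> [Bm0 Bk0]; apply: (no_common_zero z zD).
  rewrite BmE BkE /sphere_quot mulf_eq0 invr_eq0 (negbTE Ez) orbF.
  by case: eqVneq => // D0; congr Some; field; rewrite D0 Ez.
have ND0 z : `|z| < 1 -> ~ (N.[z] = 0 /\ D.[z] = 0).
  move=> zD [N0 D0]; apply: (no_common_zero z zD).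
  by have [_ -> ->] := BE z zD; rewrite N0 D0 mul0r.
split=> [b bD|a aD].
  have D0 : D != 0.
    apply: (@poly_neq0_horner _ _ 1); rewrite -normr_gt0.
    by have [gN <-] := ND 1 (normr1 _); exact: lt_le_trans gN.
  case: b bD => [c|] /= c1; last first.
    by rewrite -dD; exact: (@count_solutions_quot _ _ N D None).
  have c0 : c != 0 by rewrite -normr_gt0 (lt_trans _ c1).
  have e0 : 0 < (`|c| - 1) * g by rewrite mulr_gt0// subr_gt0.
  have dom z : `|z| = 1 -> `|N.[z]| + (`|c| - 1) * g <= `|(- c *: D).[z]|.
    move=> z1; have [gN NDz] := ND z z1; rewrite hornerZ normrM normrN -NDz.
    rewrite -lerBrDl -[X in _ * _ - X]mul1r -mulrBl.
    by rewrite ler_wpM2l// subr_ge0 ltW.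
  have <- : disk_count (N - c *: D) = k.
    rewrite addrC -scaleNr (rouche e0 dom) disk_countZ ?oppr_eq0//.
  apply: (@count_solutions_quot _ _ N D (Some c)) => //=.
  by rewrite addrC -scaleNr (rouche_neq0 e0 dom).
have e0 : 0 < (1 - `|a|) * g by rewrite mulr_gt0// subr_gt0.
have dom z : `|z| = 1 -> `|(- a *: D).[z]| + (1 - `|a|) * g <= `|N.[z]|.
  move=> z1; have [gN NDz] := ND z z1; rewrite hornerZ normrM normrN -NDz.
  rewrite -lerBrDl -[X in X - _ * _]mul1r -mulrBl.
  by rewrite ler_wpM2l// subr_ge0 ltW.
have <- : disk_count (N - a *: D) = m by rewrite -scaleNr (rouche e0 dom).
apply: (@count_solutions_quot _ _ N D (Some a)) => //=.
by rewrite -scaleNr (rouche_neq0 e0 dom).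
Qed.
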